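(* Let $N\ge2$ and let $x\in\mathbb R^N$ with $x_1>\dots>x_{N-1}>x_N=0$. For $k\ge1/2$ let $(X_{t,(0,k)})_{t\ge0}$ be the Bessel process of type $B_N$ with multiplicity $(k_1,k_2)=(0,k)$ starting at $\sqrt k\, x$, realized from the Bessel process of type $D_N$ as described in the context, with the same $N$-dimensional Brownian motion $(B_t)_{t\ge0}$ for all $k$. Let $\phi(t,x)$ be the solution of the deterministic ODE of type $D_N$ with start in $x$ (see context), let $(W_t)_{t\ge0}$ be the unique solution of $$dW_t^i=dB_t^i+\sum_{j\ne i}\left(\frac{W_t^j-W_t^i}{(\phi_i(t,x)-\phi_j(t,x))^2}-\frac{W_t^j+W_t^i}{(\phi_i(t,x)+\phi_j(t,x))^2}\right)dt\quad(i=1,\dots,N),\qquad W_0=0,$$ with the same Brownian motion, and let $\tilde W_t:=(W_t^{1},\dots,W_t^{N-1},|W_t^{N}|)$ for $t\ge0$. Then, for every $t>0$, $$\sup_{0\le s\le t,\ k\ge 1/2}\sqrt k\cdot\bigl\|X_{s,(0,k)}-\sqrt k\,\phi(s,x)-\tilde W_s\bigr\|<\infty\quad\text{almost surely}.$$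
   Context: Let $C_N^D=\{x\in\mathbb R^N:x_1\ge\dots\ge x_{N-1}\ge|x_N|\}$ and $C_N^B=\{x\in\mathbb R^N:x_1\ge\dots\ge x_N\ge0\}$. The Bessel process $(X^D_{t,k})_{t\ge0}$ of type $D_N$ with multiplicity $k$ is the $C_N^D$-valued continuous (strong) solution of $$dX_{t,k}^{D,i}=dB_t^i+k\sum_{j\ne i}\left(\frac{1}{X_{t,k}^{D,i}-X_{t,k}^{D,j}}+\frac{1}{X_{t,k}^{D,i}+X_{t,k}^{D,j}}\right)dt\qquad(i=1,\dots,N),$$ where $(B_t)_{t\ge0}$ is an $N$-dimensional Brownian motion (the same for all $k$). Convention on versions: there is an event of probability one on which, for all $k\ge1/2$ simultaneously, the path $t\mapsto X^D_{t,k}$ is continuous with values in $C_N^D$, lies in the interior for Lebesgue-almost every time, has locally integrable drift, and satisfies the integrated form of the SDE for all $t\ge0$. The Bessel process of type $B_N$ with multiplicity $(0,k)$ starting at $\sqrt k\,x$ (a diffusion on $C_N^B$ with reflecting boundary) is realized as $$X_{t,(0,k)}=\bigl(X^{D,1}_{t,k},\dots,X^{D,N-1}_{t,k},|X^{D,N}_{t,k}|\bigr),$$ where $X^D_{0,k}=\sqrt k\,x$. For $x$ in the interior of $C_N^D$ (in particular for $x_1>\dots>x_{N-1}>x_N=0$), $t\mapsto\phi(t,x)$, $t\ge0$, denotes the unique solution, which stays in the interior of $C_N^D$, of $$\frac{d}{dt}\phi_i(t,x)=\sum_{j\ne i}\left(\frac{1}{\phi_i(t,x)-\phi_j(t,x)}+\frac{1}{\phi_i(t,x)+\phi_j(t,x)}\right)\quad(i=1,\dots,N),\qquad\phi(0,x)=x.$$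 $\|\cdot\|$ is the Euclidean norm. *)

(* Defs.v *)
From HB Require Import structures.
From mathcomp Require Export all_boot all_order all_algebra.
From mathcomp Require Export all_classical all_reals all_analysis.

Set Implicit Arguments.
Unset Strict Implicit.
Unset Printing Implicit Defensive.

Export Order.TTheory GRing.Theory Num.Theory.
Export numFieldNormedType.Exports.

Local Open Scope classical_set_scope.
Local Open Scope ring_scope.

Section Vectors.
Context {R : realType} {N : nat}.
Implicit Types z w : 'rV[R]_N.

(* The norm that the library puts on matrices is the sup norm. *)
Definition enorm z : R := Num.sqrt (\sum_(i < N) z 0 i ^+ 2).

Definition abs_last z : 'rV[R]_N :=
  \row_i (if i.+1 == N then `|z 0 i| else z 0 i).

(* z_1 >= ... >= z_(N-1) >= |z_N| *)
Definition weylD : set 'rV[R]_N :=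
  [set z | forall i j : 'I_N, (i < j)%N -> abs_last z 0 j <= abs_last z 0 i].

Definition driftD z : 'rV[R]_N :=
  \row_i \sum_(j < N | j != i) ((z 0 i - z 0 j)^-1 + (z 0 i + z 0 j)^-1).

Definition driftW z w : 'rV[R]_N :=
  \row_i \sum_(j < N | j != i)
    ((w 0 j - w 0 i) / (z 0 i - z 0 j) ^+ 2
     - (w 0 j + w 0 i) / (z 0 i + z 0 j) ^+ 2).

(* The derivative is taken relative to [0, +oo[, hence one-sided at 0. *)
Definition is_phi (x : 'rV[R]_N) (phi : R -> 'rV[R]_N) : Prop :=
  phi 0 = x /\
  forall t : R, 0 <= t ->
    weylD° (phi t) /\
    forall i : 'I_N,
      (phi s 0 i - phi t 0 i) / (s - t) @[s --> within `[0, +oo[ (t^')]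
        --> driftD (phi t) 0 i.

(* y is a continuous solution on [0, +oo[ of dy = db + f(s, y_s) ds in
   integrated form, for one fixed driving path b. *)
Definition solves_integrated (b : R -> 'rV[R]_N)
    (f : R -> 'rV[R]_N -> 'rV[R]_N) (y : R -> 'rV[R]_N) : Prop :=
  {within `[0, +oo[, continuous y} /\
  forall t : R, 0 <= t -> forall i : 'I_N,
    lebesgue_measure.-integrable `[0, t] (fun s => (f s (y s) 0 i)%:E) /\
    y t 0 i = y 0 0 i + (b t 0 i - b 0 0 i)
              + \int[lebesgue_measure]_(s in `[0, t]) f s (y s) 0 i.

End Vectors.

Section Processes.
Context {d : measure_display} {Omega : measurableType d} {R : realType}.
Variable P : probability Omega R.

(* The sets [A i] may be the whole line, so the product rule over the full
   family includes the one over each subfamily. *)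
Definition mutually_independent (I : finType) (Z : I -> Omega -> R) : Prop :=
  forall A : I -> set R, (forall i, measurable (A i)) ->
    P (\bigcap_(i in [set: I]) (Z i @^-1` A i))
    = (\prod_(i : I) P (Z i @^-1` A i))%E.

Context {N : nat}.

Definition brownian_motion (B : R -> Omega -> 'rV[R]_N) : Prop :=
  [/\ forall (t : R) (i : 'I_N), 0 <= t ->
        measurable_fun [set: Omega] (fun w => B t w 0 i),
      {ae P, forall w, B 0 w = 0 /\
        {within `[0, +oo[, continuous (fun t => B t w)}},
      forall (s t : R) (i : 'I_N) (A : set R), 0 <= s -> s < t -> measurable A ->
        P ((fun w => B t w 0 i - B s w 0 i) @^-1` A)
        = normal_prob 0 (Num.sqrt (t - s)) A &
      forall (n : nat) (u : nat -> R),
        0 <= u 0 -> {homo u : l m / (l <= m)%N >-> l <= m} ->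
        mutually_independent (fun (p : 'I_n * 'I_N) w =>
          B (u p.1.+1) w 0 p.2 - B (u p.1) w 0 p.2)].

Definition natural_filtration (B : R -> Omega -> 'rV[R]_N) (t : R) :
    set (set Omega) :=
  <<s [set A | exists s (i : 'I_N) (U : set R),
        [/\ 0 <= s, s <= t, measurable U &
            A = (fun w => B s w 0 i) @^-1` U]] >>.

Definition augmented_filtration (B : R -> Omega -> 'rV[R]_N) (t : R) :
    set (set Omega) :=
  [set A | measurable A /\ exists2 A', natural_filtration B t A' &
             P.-negligible ((A `\` A') `|` (A' `\` A))].

Definition adapted (B Y : R -> Omega -> 'rV[R]_N) : Prop :=
  forall (t : R) (i : 'I_N) (U : set R), 0 <= t -> measurable U ->
    augmented_filtration B t ((fun w => Y t w 0 i) @^-1` U).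

(* X k is the Bessel process of type D with multiplicity k started at
   sqrt k x; the exceptional null set is common to all k >= 1/2. *)
Definition besselD_family (B : R -> Omega -> 'rV[R]_N) (x : 'rV[R]_N)
    (X : R -> R -> Omega -> 'rV[R]_N) : Prop :=
  (forall k, 2^-1 <= k -> adapted B (X k)) /\
  {ae P, forall w, forall k, 2^-1 <= k ->
    [/\ X k 0 w = Num.sqrt k *: x,
        forall t : R, 0 <= t -> weylD (X k t w),
        {ae lebesgue_measure, forall t : R, 0 <= t -> weylD° (X k t w)} &
        solves_integrated (B ^~ w) (fun _ z => k *: driftD z)
          (fun t => X k t w)]}.

(* The type B process with multiplicity (0, k), realized by folding the last
   coordinate of the type D process X k. *)
Definition besselB (X : R -> R -> Omega -> 'rV[R]_N) (k t : R) (w : Omega) :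
    'rV[R]_N :=
  abs_last (X k t w).

Definition is_W (B : R -> Omega -> 'rV[R]_N) (phi : R -> 'rV[R]_N)
    (W : R -> Omega -> 'rV[R]_N) : Prop :=
  adapted B W /\
  {ae P, forall w, W 0 w = 0 /\
    solves_integrated (B ^~ w) (fun s z => driftW (phi s) z) (W ^~ w)}.

End Processes.

(* Main.v *)
Require Import Defs.
From mathcomp Require Import zify ring lra.

Set Implicit Arguments.
Unset Strict Implicit.
Unset Printing Implicit Defensive.

Local Open Scope classical_set_scope.
Local Open Scope ring_scope.

(* The argument is pathwise.  Put c = sqrt k and compare X_k with the reference
   curve r = c phi + W + q / c, where q is a fixed vector well inside the
   chamber: for every positive root a, AM-GM applied to c a(phi) + a(q) / c
   keeps a(r) bounded below by c a(phi) / 2, for all k >= 1/2 at once and even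
   when c phi + W alone leaves the chamber.  The Brownian terms of X_k and W
   cancel, so y = X_k - r is absolutely continuous.  The drift of X_k is minus
   the gradient of a convex function, and c phi + W follows the linearization
   of that drift at c phi, whence y . y' <= (C / c) |y| almost everywhere and
   |y| = O(1 / c) on [0, t].  Finally phi_N = 0 since x_N = 0, so folding the
   last coordinate does not increase the error. *)

(** * Real-valued integrals and almost everywhere comparison *)

Section Integrals.
Context {d : measure_display} {T : measurableType d} {R : realType}.
Variable mu : {measure set T -> \bar R}.
Implicit Types (D : set T) (f g : T -> R).

Lemma ae_imply (Q1 Q2 : T -> Prop) :
  (forall s, Q1 s -> Q2 s) ->
  {ae mu, forall s, Q1 s} -> {ae mu, forall s, Q2 s}.
Proof. by move=> Q12 aeQ1; apply: filterS aeQ1. Qed.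

Lemma ae_le_Rintegral D f g : measurable D ->
  mu.-integrable D (EFin \o f) -> mu.-integrable D (EFin \o g) ->
  {ae mu, forall s, D s -> f s <= g s} ->
  \int[mu]_(s in D) f s <= \int[mu]_(s in D) g s.
Proof.
move=> mD intf intg [A [mA muA fgA]].
rewrite /Rintegral (negligible_integral mA mD intf muA).
rewrite (negligible_integral mA mD intg muA).
have mDA : measurable (D `\` A) by exact: measurableD.
apply: le_Rintegral => //.
- by apply: integrableS intf => //; exact: subDsetl.
- by apply: integrableS intg => //; exact: subDsetl.
- move=> s [Ds nAs]; apply: contra_notP nAs => nfg.
  by apply: fgA => /= /(_ Ds).
Qed.

Lemma integrable_sum_EFin (I : finType) D (f : I -> T -> R) : measurable D ->
  (forall i, mu.-integrable D (EFin \o f i)) ->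
  mu.-integrable D (EFin \o (fun s => \sum_i f i s)).
Proof.
move=> mD intf.
rewrite (_ : _ \o _ = fun s => (\sum_i (EFin \o f i) s)%E).
  exact: integrable_sum.
by apply/funext => s /=; rewrite sumEFin.
Qed.

Lemma Rintegral_sum (I : finType) D (f : I -> T -> R) : measurable D ->
  (forall i, mu.-integrable D (EFin \o f i)) ->
  \int[mu]_(s in D) (\sum_i f i s) = \sum_i \int[mu]_(s in D) f i s.
Proof.
move=> mD intf; rewrite /Rintegral.
have := integral_sum mD intf (index_enum I) xpredT.
rewrite (_ : (fun s => _) = fun s => (\sum_i f i s)%:E); last first.
  by apply/funext => s; rewrite sumEFin.
by move=> ->; rewrite -sum_fine// => i _; exact: integrable_fin_num.
Qed.

Lemma integrable_scale (c : R) D f : measurable D ->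
  mu.-integrable D (EFin \o f) ->
  mu.-integrable D (EFin \o (fun s => c * f s)).
Proof.
move=> mD intf.
rewrite (_ : _ \o _ = fun s => (c%:E * (EFin \o f) s)%E)//.
exact: integrableZl.
Qed.

Lemma integrable_diff D f g : measurable D ->
  mu.-integrable D (EFin \o f) -> mu.-integrable D (EFin \o g) ->
  mu.-integrable D (EFin \o (fun s => f s - g s)).
Proof.
move=> mD intf intg.
by rewrite (_ : _ \o _ = ((EFin \o f) \- (EFin \o g))%E)//; exact: integrableB.
Qed.

End Integrals.

Section LebesgueIntervals.
Context {R : realType}.
Notation mu := (@lebesgue_measure R).

Lemma sub_itv_cc (a b t : R) : 0 <= a -> b <= t -> `[a, b] `<=` `[0, t].
Proof. by move=> a0 bt; apply: subset_itv; rewrite bnd_simp. Qed.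

Lemma Rintegral_itv_diff (f : R -> R) (a b t : R) :
  0 <= a -> a <= b -> b <= t ->
  mu.-integrable `[0, t] (EFin \o f) ->
  \int[mu]_(s in `[0, b]) f s - \int[mu]_(s in `[0, a]) f s
    = \int[mu]_(s in `[a, b]) f s.
Proof.
move=> a0 ab bt intf.
have intb : mu.-integrable `[0, b] (EFin \o f).
  by apply: integrableS intf => //; exact: sub_itv_cc.
rewrite Rintegral_itvB ?bnd_simp// Rintegral_itv_obnd_cbnd//.
by apply: integrableS intb => //; apply: subset_itv; rewrite bnd_simp.
Qed.

End LebesgueIntervals.

(* Splitting [a, b] where H is halfway halves the quadratic bound; in the limit
   an increment dominated by a squared increment of H is nonpositive. *)
Lemma half_sqr_bound {R : realType} (E H : R -> R) (t : R) :
  {within `[0, t], continuous H} ->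
  (forall a b, 0 <= a -> a <= b -> b <= t -> H a <= H b) ->
  (forall a b, 0 <= a -> a <= b -> b <= t -> E b - E a <= (H b - H a) ^+ 2) ->
  forall n a b, 0 <= a -> a <= b -> b <= t ->
    E b - E a <= (H b - H a) ^+ 2 / 2 ^+ n.
Proof.
move=> cH Hmono EH; elim=> [|n IHn] a b a0 ab bt.
  by rewrite expr0 divr1; exact: EH.
have Hab := Hmono _ _ a0 ab bt.
have [c] : exists2 c, c \in `[a, b] & H c = (H a + H b) / 2.
  apply: IVT => //.
    by apply: continuous_subspaceW cH; exact: sub_itv_cc.
  by rewrite min_l// max_r//; apply/andP; split; lra.
rewrite in_itv/= => /andP[ac cb] Hc.
have ec := IHn _ _ a0 ac (le_trans cb bt).
have cb' := IHn _ _ (le_trans a0 ac) cb bt.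
have p2 : 0 < (2 : R) ^+ n by rewrite exprn_gt0.
rewrite (exprS 2) invfM.
move: ec cb'; rewrite Hc.
set p := (2 ^+ n)^-1 => ec cb'.
suff -> : (H b - H a) ^+ 2 * (2^-1 * p) =
  ((H a + H b) / 2 - H a) ^+ 2 * p + (H b - (H a + H b) / 2) ^+ 2 * p by lra.
by field.
Qed.

Lemma le_of_half_sqr_bound {R : realType} (E H : R -> R) (t : R) : 0 <= t ->
  {within `[0, t], continuous H} ->
  (forall a b, 0 <= a -> a <= b -> b <= t -> H a <= H b) ->
  (forall a b, 0 <= a -> a <= b -> b <= t -> E b - E a <= (H b - H a) ^+ 2) ->
  E t <= E 0.
Proof.
move=> t0 cH Hmono EH; rewrite -subr_le0.
set e := E t - E 0; set L := (H t - H 0) ^+ 2.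
have eL n : e <= L / 2 ^+ n by exact: half_sqr_bound.
rewrite leNgt; apply/negP => e0.
have L0 : 0 <= L by exact: sqr_ge0.
(* Any [n > L / e] works: [2 ^ n > n] then forces [L / 2 ^ n < e]. *)
pose n := (Num.truncn (L / e)).+1.
have := eL n; rewrite leNgt => /negP; apply.
rewrite ltr_pdivrMr ?exprn_gt0// mulrC -ltr_pdivrMr//.
apply: (lt_trans (truncnS_gt _)).
by rewrite -natrX ltr_nat; exact: ltn_expl.
Qed.

(** * Energy estimates for absolutely continuous curves *)

Section Energy.
Context {R : realType} {n : nat}.
Notation mu := (@lebesgue_measure R).
Variables (t : R) (y h : 'I_n -> R -> R).
Hypothesis inth : forall i, mu.-integrable `[0, t] (EFin \o h i).
Hypothesis yE : forall i (s : R), 0 <= s -> s <= t ->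
  y i s = y i 0 + \int[mu]_(u in `[0, s]) h i u.

(** A common modulus of variation: each coordinate of [y] oscillates by at most the increment of
    [H], which is continuous and nondecreasing as [le_of_half_sqr_bound] requires. *)
Let H (s : R) := \int[mu]_(u in `[0, s]) (\sum_i `|h i u|).

Let intabs i : mu.-integrable `[0, t] (EFin \o (fun u => `|h i u|)).
Proof. exact: integrable_norm. Qed.

Let intH : mu.-integrable `[0, t] (EFin \o (fun u => \sum_i `|h i u|)).
Proof. exact: integrable_sum_EFin. Qed.

Let HE (a b : R) : 0 <= a -> a <= b -> b <= t ->
  H b - H a = \int[mu]_(u in `[a, b]) (\sum_i `|h i u|).
Proof. by move=> a0 ab bt; rewrite (Rintegral_itv_diff a0 ab bt). Qed.

Let H_mono (a b : R) : 0 <= a -> a <= b -> b <= t -> H a <= H b.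
Proof.
move=> a0 ab bt; rewrite -subr_ge0 HE//.
by apply: Rintegral_ge0 => u _; rewrite sumr_ge0.
Qed.

Let y_diff i (a b : R) : 0 <= a -> a <= b -> b <= t ->
  y i b - y i a = \int[mu]_(u in `[a, b]) h i u.
Proof.
move=> a0 ab bt; rewrite (yE _ a0 (le_trans ab bt)) (yE _ (le_trans a0 ab) bt).
by rewrite opprD addrACA subrr add0r; exact: Rintegral_itv_diff bt _.
Qed.

Let y_osc i (a b : R) : 0 <= a -> a <= b -> b <= t ->
  `|y i b - y i a| <= H b - H a.
Proof.
move=> a0 ab bt; rewrite y_diff// HE//.
have sub : `[a, b] `<=` `[0, t] by exact: sub_itv_cc.
apply: (le_trans (le_normr_Rintegral _ _)) => //.
  by apply: integrableS (inth i).
apply: le_Rintegral => //.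
- by apply: integrableS (intabs i).
- by apply: integrableS intH.
- by move=> u _; rewrite (bigD1 i)//= lerDl sumr_ge0.
Qed.

Lemma energy_continuous i : 0 <= t -> {within `[0, t], continuous (y i)}.
Proof.
move=> t0.
apply: (@subspace_eq_continuous R `[0, t] R
    (fun s => y i 0 + \int[mu]_(u in `[0, s]) h i u) (y i)).
  by move=> s; rewrite inE/= in_itv/= => /andP[s0 st]; symmetry; exact: yE.
apply/subspace_continuousP => s st; apply: cvgD; first exact: cvg_cst.
move: s st; apply/subspace_continuousP.
exact: parameterized_integral_continuous.
Qed.

(** Integrated form of [(|y|^2)' = 2 y . h]. No derivative of [y] is taken: over each subinterval
    the increment of [E] is at most the squared increment of [H], so [E] cannot grow. *)
Lemma energy_le (C : R) : 0 <= t ->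
  {ae mu, forall s, 0 <= s <= t -> \sum_i y i s * h i s <= C} ->
  \sum_i y i t ^+ 2 <= \sum_i y i 0 ^+ 2 + 2 * C * t.
Proof.
move=> t0 aeC.
pose E s := \sum_i y i s ^+ 2 - 2 * C * s.
suff : E t <= E 0 by rewrite /E; lra.
apply: (@le_of_half_sqr_bound _ E H t) => //.
  exact: parameterized_integral_continuous.
move=> a b a0 ab bt.
have sub : `[a, b] `<=` `[0, t] by exact: sub_itv_cc.
have mab : measurable (`[a, b]%classic : set R) by [].
have inthab i : mu.-integrable `[a, b] (EFin \o h i).
  by apply: integrableS (inth i).
(* Each difference of squares factors as [(y a + y b) (y b - y a)], and the second factor is the
   integral of [h]. *)
have -> : E b - E a = \int[mu]_(s in `[a, b])
    (\sum_i (y i a + y i b) * h i s) - 2 * C * (b - a).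
  rewrite Rintegral_sum//; last by move=> i; exact: integrable_scale.
  rewrite /E; under [X in _ = X - _]eq_bigr => i _.
    rewrite RintegralZl// -y_diff// (_ : _ * _ = y i b ^+ 2 - y i a ^+ 2).
      over.
    by ring.
  by rewrite sumrB; ring.
have muab : fine (mu `[a, b]) = b - a.
  rewrite lebesgue_measure_itv/= lte_fin.
  by case: ltgtP ab => // -> _; rewrite subrr.
rewrite lerBlDr.
have intC : mu.-integrable `[a, b] (EFin \o (fun=> 2 * C)).
  apply: (@continuous_compact_integrable R (fun=> 2 * C)).
    exact: segment_compact.
  by move=> s; exact: cvg_cst.
have -> : (H b - H a) ^+ 2 + 2 * C * (b - a) =
    \int[mu]_(s in `[a, b]) ((H b - H a) * (\sum_i `|h i s|) + 2 * C).
  rewrite RintegralD//=.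
  - rewrite RintegralZl//; last by apply: integrableS intH.
    by rewrite -HE// Rintegral_cst// muab expr2.
  - by apply: integrable_scale => //; apply: integrableS intH.
have intHab : mu.-integrable `[a, b] (EFin \o (fun u => \sum_i `|h i u|)).
  by apply: integrableS intH.
apply: ae_le_Rintegral => //.
- by apply: integrable_sum_EFin => // i; exact: integrable_scale.
- rewrite (_ : _ \o _ = (EFin \o (fun s => (H b - H a) * (\sum_i `|h i s|)))
    \+ (EFin \o cst (2 * C))) => [|//].
  by apply: integrableD => //; exact: integrable_scale.
- apply: ae_imply aeC => s sC; rewrite /= in_itv/= => /andP[sa sb].
  have s0 := le_trans a0 sa; have st := le_trans sb bt.
  have {}sC := sC (introT andP (conj s0 st)).
  (* y a + y b is 2 y s up to the variation H b - H a, so integrating the error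
     over [a, b] gives a term quadratic in H b - H a. *)
  have -> : \sum_i (y i a + y i b) * h i s = 2 * (\sum_i y i s * h i s) +
      \sum_i ((y i b - y i s) - (y i s - y i a)) * h i s.
    by rewrite mulr_sumr -big_split/=; apply: eq_bigr => i _; ring.
  rewrite addrC lerD//; last by rewrite ler_pM2l.
  rewrite mulr_sumr; apply: ler_sum => i _.
  apply: (le_trans (ler_norm _)); rewrite normrM ler_wpM2r//.
  apply: (le_trans (ler_normB _ _)).
  have := y_osc i s0 sb bt; have := y_osc i a0 sa st; lra.
Qed.

End Energy.

(** At a time [c] where the norm attains its maximum [M] on [[0, t]], [energy_le] with the constant
    [K * M] gives [M^2 <= m0^2 + 2 K M c]. If [M > m0], then [m0^2 <= m0 M] and dividing by [M]
    makes the bound linear; the norm of [y] at other times may vanish. *)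
Lemma energy_norm_le {R : realType} {n : nat} (t K : R) (y h : 'I_n -> R -> R) :
  (forall i, lebesgue_measure.-integrable `[0, t] (EFin \o h i)) ->
  (forall i (s : R), 0 <= s -> s <= t ->
    y i s = y i 0 + \int[lebesgue_measure]_(u in `[0, s]) h i u) ->
  0 <= t -> 0 <= K ->
  {ae lebesgue_measure, forall s : R, 0 <= s <= t ->
    \sum_i y i s * h i s <= K * Num.sqrt (\sum_i y i s ^+ 2)} ->
  Num.sqrt (\sum_i y i t ^+ 2) <= Num.sqrt (\sum_i y i 0 ^+ 2) + 2 * K * t.
Proof.
move=> inth yE t0 K0 aeK.
have cy i : {within `[0, t], continuous (y i)}.
  exact: (energy_continuous inth yE).
have sum_ge0 s : 0 <= \sum_i y i s ^+ 2.
  by apply: sumr_ge0 => i _; exact: sqr_ge0.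
have [c cI cmax] : exists2 c, c \in `[0, t] &
    forall s, s \in `[0, t] -> \sum_i y i s ^+ 2 <= \sum_i y i c ^+ 2.
  apply: EVT_max => //; apply/subspace_continuousP => s sI.
  apply: cvg_big => [|i _]; first exact: add_continuous.
  by apply: cvgM; exact: (iffLR (subspace_continuousP _ _) (cy i) s sI).
move: (cI); rewrite in_itv/= => /andP[c0 ct].
set M := Num.sqrt (\sum_i y i c ^+ 2); set m0 := Num.sqrt (\sum_i y i 0 ^+ 2).
have M0 : 0 <= M by exact: sqrtr_ge0.
have m00 : 0 <= m0 by exact: sqrtr_ge0.
have MM : M ^+ 2 <= m0 ^+ 2 + 2 * (K * M) * c.
  rewrite !sqr_sqrtr//; apply: (@energy_le _ _ c y h) => //.
  - by move=> i; apply: integrableS (inth i) => //; exact: sub_itv_cc.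
  - by move=> i s s0 sc; apply: yE => //; exact: le_trans ct.
  - apply: ae_imply aeK => s sK /andP[s0 sc].
    have st := le_trans sc ct.
    apply: (le_trans (sK _)); first by rewrite s0.
    by rewrite ler_wpM2l// ler_wsqrtr// cmax// in_itv/= s0.
have tM : Num.sqrt (\sum_i y i t ^+ 2) <= M.
  by rewrite ler_wsqrtr// cmax// in_itv/= t0 lexx.
apply: (le_trans tM).
have Kct : 2 * K * c <= 2 * K * t by rewrite ler_wpM2l// mulr_ge0.
have K2c : 0 <= 2 * K * c by rewrite !mulr_ge0.
have [Mm|mM] := leP M m0; first by lra.
apply: (@le_trans _ _ (m0 + 2 * K * c)); last by lra.
rewrite -(ler_pM2r (le_lt_trans m00 mM)).
have : m0 * m0 <= m0 * M by rewrite ler_wpM2l// ltW.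
by move: MM; rewrite !expr2; lra.
Qed.

(** * The open chamber and monotonicity of the drift *)

Section Chamber.
Context {R : realType} {N : nat}.
Implicit Types z r : 'rV[R]_N.

(** Equivalently, all positive roots [z_i - z_j] and [z_i + z_j], [i < j], are positive at [z]. *)
Definition strict_chamber z := forall i j : 'I_N, (i < j)%N -> `|z 0 j| < z 0 i.

(** If [j] is not the last index, [z_j] dominates the absolute value of the last coordinate, hence
    is its own absolute value. *)
Lemma weylD_norm_le z (i j : 'I_N) : weylD z -> (i < j)%N -> `|z 0 j| <= z 0 i.
Proof.
move=> wz ij.
have iN : i.+1 == N = false.
  by apply/negbTE; rewrite neq_ltn (leq_ltn_trans ij).
have Ngt0 : (0 < N)%N by exact: leq_trans (ltn_ord i).
have := wz _ _ ij; rewrite /abs_last !mxE iN.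
case: eqP => // jN zji; rewrite ger0_norm//.
have N0 : (N.-1 < N)%N by rewrite ltn_predL.
have jl : (j < Ordinal N0)%N.
  rewrite /= ltn_neqAle; apply/andP; split; last by rewrite -ltnS prednK.
  by apply/eqP => jE; apply: jN; rewrite jE prednK.
have := wz _ _ jl; rewrite /abs_last !mxE/= prednK// eqxx.
by case: eqP => // _; exact: le_trans.
Qed.

(** Lowering the [i]-th coordinate alone by [e / 2] stays in the closed chamber, which makes the
    weak inequality strict at [z]. *)
Lemma interior_weylD z : weylD° z -> strict_chamber z.
Proof.
move=> /nbhs_ballP[e /= e0 ez] i j ij.
have /ez/weylD_norm_le/(_ ij) : ball z e (z - (e / 2) *: delta_mx 0 i).
  split=> // k l; rewrite -ball_normE /ball_/= !mxE opprB addrC subrK.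
  rewrite normrM gtr0_norm ?divr_gt0//.
  apply: (@le_lt_trans _ _ (e / 2 * 1)); last by lra.
  by rewrite ler_pM2l ?divr_gt0//; case: (_ && _); rewrite ?normr1 ?normr0.
rewrite !mxE !eqxx/= (_ : (j == i) = false) ?mulr0 ?mulr1 ?subr0; last first.
  by apply/negbTE; apply: contraTN ij => /eqP ->; rewrite ltnn.
by move=> /le_lt_trans; apply; rewrite ltrBlDr ltrDl divr_gt0.
Qed.

Lemma strict_chamber_sub z (i j : 'I_N) : strict_chamber z -> (i < j)%N ->
  0 < z 0 i - z 0 j.
Proof.
move=> zs ij; rewrite subr_gt0.
by apply: le_lt_trans (zs _ _ ij); exact: ler_norm.
Qed.

Lemma strict_chamber_add z (i j : 'I_N) : strict_chamber z -> j != i ->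
  0 < z 0 i + z 0 j.
Proof.
move=> zs; rewrite neq_ltn => /orP[] /zs; last first.
  by have := ler_norm (- z 0 j); rewrite normrN; lra.
by have := ler_norm (- z 0 i); rewrite normrN; lra.
Qed.

Lemma sum_offdiag_sym (F : 'I_N -> 'I_N -> R) :
  2 * \sum_i \sum_(j | j != i) F i j = \sum_i \sum_(j | j != i) (F i j + F j i).
Proof.
under [RHS]eq_bigr do rewrite big_split/=.
rewrite big_split/= mulr_natl mulr2n; congr (_ + _).
rewrite (exchange_big_dep xpredT)//=; apply: eq_bigr => i _.
by apply: eq_bigl => j; rewrite eq_sym.
Qed.

(** Inversion is decreasing on each open half-line, and [0 < a * b] puts both points on the same
    one. *)
Lemma inv_sub_mul_le0 (a b : R) : 0 < a * b -> (a - b) * (a^-1 - b^-1) <= 0.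
Proof.
move=> ab0.
have /andP[a0 b0] : (a != 0) && (b != 0) by rewrite -negb_or -mulf_eq0 gt_eqF.
have -> : (a - b) * (a^-1 - b^-1) = - ((a - b) ^+ 2 / (a * b)).
  by field; rewrite a0 b0.
by rewrite oppr_le0 divr_ge0 ?sqr_ge0// ltW.
Qed.

(* driftD is minus the gradient of a convex function on the open chamber. *)
Lemma driftD_antimonotone z r : strict_chamber z -> strict_chamber r ->
  \sum_i (z 0 i - r 0 i) * (driftD z 0 i - driftD r 0 i) <= 0.
Proof.
move=> zs rs; rewrite -(pmulr_rle0 _ (ltr0n R 2)).
pose A i j := ((z 0 i - z 0 j)^-1 - (r 0 i - r 0 j)^-1).
pose S i j := ((z 0 i + z 0 j)^-1 - (r 0 i + r 0 j)^-1).
have -> : \sum_i (z 0 i - r 0 i) * (driftD z 0 i - driftD r 0 i) =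
    \sum_i \sum_(j | j != i) (z 0 i - r 0 i) * (A i j + S i j).
  apply: eq_bigr => i _; rewrite !mxE -sumrB mulr_sumr; apply: eq_bigr => j _.
  by rewrite /A /S; congr (_ * _); ring.
rewrite sum_offdiag_sym; apply: sumr_le0 => i _; apply: sumr_le0 => j ji.
(* [A] is antisymmetric and [S] symmetric in [i, j], so the pair regroups into one term for each of
   the two roots. *)
have -> : (z 0 i - r 0 i) * (A i j + S i j) +
    (z 0 j - r 0 j) * (A j i + S j i) =
    ((z 0 i - z 0 j) - (r 0 i - r 0 j)) * A i j +
    ((z 0 i + z 0 j) - (r 0 i + r 0 j)) * S i j.
  rewrite (_ : A j i = - A i j); last first.
    by rewrite /A -(opprB (z 0 i)) -(opprB (r 0 i)) !invrN; ring.
  rewrite (_ : S j i = S i j); first by ring.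
  by rewrite /S (addrC (z 0 j)) (addrC (r 0 j)).
rewrite -[leRHS]addr0; apply: lerD; apply: inv_sub_mul_le0.
  move: ji; rewrite neq_ltn => /orP[] ij.
    have := strict_chamber_sub zs ij; have := strict_chamber_sub rs ij; nra.
  have := strict_chamber_sub zs ij; have := strict_chamber_sub rs ij; nra.
by rewrite mulr_gt0// strict_chamber_add.
Qed.

End Chamber.

(** * First-order expansion along a single root *)

Section Linearization.
Context {R : realType}.

(** A numerator at most [a P + V^2 + 2 V P] over a denominator at least [k a^3 / 2], with [a] then
    replaced by its lower bound [d] and the factor [1 / k] left out. *)
Definition remainder_cst (d V P : R) : R :=
  2 * (P / d ^+ 2 + (V ^+ 2 + 2 * V * P) / d ^+ 3).

Lemma remainder_cst_ge0 (d V P : R) : 0 < d -> 0 <= V -> 0 <= P ->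
  0 <= remainder_cst d V P.
Proof.
move=> /ltW d0 V0 P0; rewrite /remainder_cst.
rewrite mulr_ge0// addr_ge0// divr_ge0 ?exprn_ge0//.
by rewrite addr_ge0 ?sqr_ge0// !mulr_ge0.
Qed.

(** Here [k] stands for the square root of the multiplicity. The last hypothesis lets half of
    [k a + p / k] absorb [w], so the denominator stays above [k a / 2]. *)
Lemma inv_linearization (k d V P a w p : R) :
  0 < k -> 1 <= 2 * k ^+ 2 -> 0 < d -> d <= a -> `|w| <= V -> 0 <= p <= P ->
  2 * V <= k * a + p / k ->
  0 < k * a + w + p / k /\
  `|k ^+ 2 / (k * a + w + p / k) - k / a + w / a ^+ 2|
    <= remainder_cst d V P / k.
Proof.
move=> k0 k1 d0 da wV /andP[p0 pP] hV.
have a0 : 0 < a by lra.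
have ka0 : 0 < k * a by rewrite mulr_gt0.
have pk0 : 0 <= p / k by rewrite divr_ge0// ltW.
have : - V <= w by move: wV; rewrite ler_norml => /andP[].
set D := k * a + w + p / k => wV'.
have D2 : k * a / 2 <= D by rewrite /D; lra.
have D0 : 0 < D by lra.
split => //.
(* Over the common denominator the terms of order [k^2] and [k] cancel, leaving a numerator bounded
   in [k]. *)
have -> : k ^+ 2 / D - k / a + w / a ^+ 2 =
    (- (a * p) + w ^+ 2 + w * p / k) / (a ^+ 2 * D).
  have kD : (k * a + w) * k + p = k * D by rewrite /D; field; rewrite gt_eqF.
  by rewrite /D; field; rewrite kD !gt_eqF// mulr_gt0.
have V0 : 0 <= V by exact: le_trans wV.
have P0 : 0 <= P by exact: le_trans pP.
have n_le : `|- (a * p) + w ^+ 2 + w * p / k| <= a * P + V ^+ 2 + 2 * V * P.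
  (* The lower bound on [k] enters here and produces the factor 2 in [2 V P]. *)
  have k2 : k^-1 <= 2 by rewrite invf_ple ?posrE//; nra.
  apply: (le_trans (ler_normD _ _)); apply: lerD.
    apply: (le_trans (ler_normD _ _)); apply: lerD.
      by rewrite normrN normrM (gtr0_norm a0) (ger0_norm p0) ler_pM2l.
    by rewrite normrX ler_pXn2r// nnegrE.
  rewrite !normrM (ger0_norm p0) normfV (gtr0_norm k0).
  rewrite (_ : 2 * V * P = V * P * 2); last by ring.
  by apply: ler_pM => //; [rewrite mulr_ge0|rewrite invr_ge0 ltW|exact: ler_pM].
rewrite normrM normfV [X in _ / X]gtr0_norm ?mulr_gt0 ?exprn_gt0//.
rewrite ler_pdivrMr ?mulr_gt0 ?exprn_gt0//; apply: (le_trans n_le).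
set n := _ + _ + _ in n_le *.
apply: (@le_trans _ _ (remainder_cst d V P / k * (a ^+ 2 * (k * a / 2))));
  last first.
  rewrite ler_wpM2l//; last by rewrite ler_pM2l ?exprn_gt0.
  by apply: divr_ge0; [exact: remainder_cst_ge0|exact: ltW].
have -> : remainder_cst d V P / k * (a ^+ 2 * (k * a / 2)) =
   a * P * (a / d) ^+ 2 + (V ^+ 2 + 2 * V * P) * (a / d) ^+ 3.
  by rewrite /remainder_cst; field; rewrite !gt_eqF.
have ad : 1 <= a / d by rewrite ler_pdivlMr// mul1r.
rewrite /n -addrA; apply: lerD; rewrite ler_peMr ?exprn_ege1//.
  by rewrite mulr_ge0// ltW.
by rewrite addr_ge0 ?sqr_ge0// !mulr_ge0.
Qed.

End Linearization.

(** * Linearization of the whole drift *)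

Section DriftLinearization.
Context {R : realType} {N : nat}.
Variables (k d V P : R) (f w q : 'rV[R]_N).
Hypotheses (k0 : 0 < k) (k1 : 1 <= 2 * k ^+ 2) (d0 : 0 < d)
  (P0 : 0 <= P).
Hypothesis wV : forall i, `|w 0 i| <= V / 2.
Hypothesis fsub : forall i j : 'I_N, (i < j)%N -> d <= f 0 i - f 0 j.
Hypothesis fadd : forall i j : 'I_N, j != i -> d <= f 0 i + f 0 j.
Hypothesis qsub : forall i j : 'I_N, (i < j)%N ->
  V ^+ 2 / d <= q 0 i - q 0 j <= P.
Hypothesis qadd : forall i j : 'I_N, j != i ->
  V ^+ 2 / d <= q 0 i + q 0 j <= P.

(** [f] and [w] are the values of [phi] and [W] at one time; coordinates of [w] bounded by [V / 2]
    make every root of [w] bounded by [V]. *)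
Let r := k *: f + w + k^-1 *: q.

(* AM-GM makes the shift [q / k] absorb [w] for all [k] simultaneously. *)
Let absorb (a p : R) : 0 <= V -> d <= a -> V ^+ 2 / d <= p ->
  2 * V <= k * a + p / k.
Proof.
move=> V0 da Vp; apply: (@le_trans _ _ (k * d + V ^+ 2 / d / k)); last first.
  by rewrite lerD ?ler_pM2l// ler_pM2r ?invr_gt0.
rewrite -subr_ge0.
have -> : k * d + V ^+ 2 / d / k - 2 * V = (k * d - V) ^+ 2 / (k * d).
  by field; rewrite !gt_eqF.
by rewrite divr_ge0 ?sqr_ge0// mulr_ge0// ltW.
Qed.

(** [a], [w1] and [p] are the values of one positive root at [f], [w] and [q]. *)
Let root (a w1 p : R) : d <= a -> `|w1| <= V -> V ^+ 2 / d <= p <= P ->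
  0 < k * a + w1 + p / k /\
  `|k ^+ 2 / (k * a + w1 + p / k) - k / a + w1 / a ^+ 2|
    <= remainder_cst d V P / k.
Proof.
move=> da w1V /andP[Vp pP]; have V0 : 0 <= V by exact: le_trans w1V.
apply: inv_linearization => //; last exact: absorb.
by rewrite pP andbT; apply: le_trans Vp; rewrite divr_ge0 ?sqr_ge0// ltW.
Qed.

Let wsub i j : `|w 0 i - w 0 j| <= V.
Proof.
apply: (le_trans (ler_normB _ _)).
by have := wV i; have := wV j; lra.
Qed.

Let wadd i j : `|w 0 i + w 0 j| <= V.
Proof.
apply: (le_trans (ler_normD _ _)).
by have := wV i; have := wV j; lra.
Qed.

Let rsub i j : r 0 i - r 0 j =
  k * (f 0 i - f 0 j) + (w 0 i - w 0 j) + (q 0 i - q 0 j) / k.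
Proof. by rewrite /r !mxE; ring. Qed.

Let radd i j : r 0 i + r 0 j =
  k * (f 0 i + f 0 j) + (w 0 i + w 0 j) + (q 0 i + q 0 j) / k.
Proof. by rewrite /r !mxE; ring. Qed.

Lemma shifted_strict_chamber : strict_chamber r.
Proof.
move=> i j ij; have ji : j != i by rewrite neq_ltn ij orbT.
have [s0 _] := root (fsub ij) (wsub i j) (qsub ij).
have [a0 _] := root (fadd ji) (wadd i j) (qadd ji).
rewrite ltr_norml; move: s0 a0; rewrite -rsub -radd => s0 a0.
by apply/andP; split; lra.
Qed.

(** [driftW f] is the differential of [driftD] at [f], and [driftD] is homogeneous of degree -1; the
    error is summed over at most two roots for each [j]. *)
Lemma driftD_linearization i :
  `|k ^+ 2 * driftD r 0 i - k * driftD f 0 i - driftW f w 0 i|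
    <= N%:R * (2 * (remainder_cst d V P / k)).
Proof.
pose E (a w1 p : R) := k ^+ 2 / (k * a + w1 + p / k) - k / a + w1 / a ^+ 2.
have -> : k ^+ 2 * driftD r 0 i - k * driftD f 0 i - driftW f w 0 i =
   \sum_(j | j != i) (E (f 0 i - f 0 j) (w 0 i - w 0 j) (q 0 i - q 0 j) +
                      E (f 0 i + f 0 j) (w 0 i + w 0 j) (q 0 i + q 0 j)).
  rewrite [driftD r 0 i]mxE [driftD f 0 i]mxE [driftW f w 0 i]mxE.
  rewrite !mulr_sumr -!sumrB; apply: eq_bigr => j _.
  by rewrite rsub radd /E; ring.
(* Oddness reduces the case [j < i], where [f_i - f_j] is negative, to a positive root. *)
have EN a w1 p : E (- a) (- w1) (- p) = - E a w1 p.
  rewrite /E (_ : k * - a - w1 + - p / k = - (k * a + w1 + p / k));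
    last by ring.
  by rewrite !invrN sqrrN; ring.
have C0 : 0 <= remainder_cst d V P / k.
  apply: divr_ge0; last exact: ltW.
  by apply: remainder_cst_ge0 => //; exact: le_trans (wsub i i).
apply: (le_trans (ler_norm_sum _ _ _)).
apply: (@le_trans _ _ (\sum_(j < N) 2 * (remainder_cst d V P / k))); last first.
  by rewrite sumr_const card_ord -[leLHS]mulr_natl.
rewrite [leLHS]big_mkcond/=; apply: ler_sum => j _.
case: ifPn => ji; last by rewrite mulr_ge0.
apply: (le_trans (ler_normD _ _)); rewrite mulr_natl mulr2n; apply: lerD.
  move: (ji); rewrite neq_ltn => /orP[] ij.
    rewrite -normrN -EN !opprB.
    by have [] := root (fsub ij) (wsub j i) (qsub ij).
  by have [] := root (fsub ij) (wsub i j) (qsub ij).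
by have [] := root (fadd ji) (wadd i j) (qadd ji).
Qed.

End DriftLinearization.

(** * Uniform bounds on a compact time interval *)

Section FiniteFamilies.
Context {R : realType} {I : finType}.
Variables (t : R) (Q : pred I) (g : I -> R -> R).
Hypothesis t0 : 0 <= t.
Hypothesis cg : forall i, Q i -> {within `[0, t], continuous (g i)}.

Lemma finite_family_ub : exists2 M : R, 0 < M &
  forall i (s : R), Q i -> 0 <= s -> s <= t -> g i s <= M.
Proof.
have ex i : exists M : R, Q i -> forall s, 0 <= s -> s <= t -> g i s <= M.
  have [Qi|] := boolP (Q i); last by exists 0.
  have [c _ cmax] := EVT_max t0 (cg Qi).
  by exists (g i c) => _ s s0 st; apply: cmax; rewrite in_itv/= s0.
have [M MP] := choice ex.
exists (1 + \sum_i `|M i|); first by rewrite ltr_pwDl// sumr_ge0.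
move=> i s Qi s0 st; apply: (le_trans (MP i Qi s s0 st)).
apply: (le_trans (ler_norm _)).
rewrite (bigD1 i)//= addrCA lerDl addr_ge0// sumr_ge0//.
Qed.

End FiniteFamilies.

(** Invert a positive upper bound of the continuous functions [1 / g i]. *)
Lemma finite_family_lb {R : realType} {I : finType} (t : R) (Q : pred I)
    (g : I -> R -> R) : 0 <= t ->
  (forall i, Q i -> {within `[0, t], continuous (g i)}) ->
  (forall i (s : R), Q i -> 0 <= s -> s <= t -> 0 < g i s) ->
  exists2 d : R, 0 < d &
    forall i (s : R), Q i -> 0 <= s -> s <= t -> d <= g i s.
Proof.
move=> t0 cg g0.
have [i Qi|M M0 MP] := @finite_family_ub R I t Q (fun i s => (g i s)^-1) t0.
  apply/subspace_continuousP => s sI.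
  have /andP[s0 st] : 0 <= s <= t by move: sI; rewrite /= in_itv.
  apply: cvgV; first by rewrite gt_eqF// g0.
  exact: (iffLR (subspace_continuousP _ _) (cg i Qi) s sI).
exists M^-1; first by rewrite invr_gt0.
move=> i s Qi s0 st; rewrite invf_ple ?posrE// ?g0//.
exact: MP.
Qed.

(** * Difference quotients relative to a set *)

Lemma cvg_punctured_within {R : realType} (A : set R) (f : R -> R) (t : R) :
  f s @[s --> within A (t^')] --> f t -> f s @[s --> within A (nbhs t)] --> f t.
Proof.
move=> /cvgrPdist_lt ft; apply/cvgrPdist_lt => e e0.
have := ft e e0; rewrite !near_withinE; apply: filterS => s sP As.
have [->|st] := eqVneq s t; first by rewrite subrr normr0.
exact: sP.
Qed.

Lemma difference_quotient_derive1 {R : realType} (A : set R) (f : R -> R)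
    (t l : R) :
  nbhs t A -> (f s - f t) / (s - t) @[s --> within A (t^')] --> l ->
  derivable f t 1 /\ derive1 f t = l.
Proof.
move=> At ft.
have H : h^-1 *: (f (h + t) - f t) @[h --> 0^'] --> l.
  apply/cvgrPdist_lt => e e0.
  move: ft => /cvgrPdist_lt/(_ e e0); rewrite !near_withinE => H.
  have {}H : \forall s \near t, s != t -> `|l - (f s - f t) / (s - t)| < e.
    by apply: filterS2 At H => s As sP st; exact: sP.
  suff : nbhs (0 : R)
    [set h | h != 0 -> `|l - h^-1 *: (f (h + t) - f t)| < e] by [].
  move: H => /nbhs_ballP[r /= r0 rP].
  apply/nbhs_ballP; exists r => // h; rewrite /ball/= sub0r normrN => hr h0.
  have := rP (h + t).
  rewrite /ball/= opprD addrCA subrr addr0 normrN => /(_ hr).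
  rewrite addrK mulrC; apply.
  by rewrite -subr_eq0 addrK.
split; last exact/cvg_lim.
apply: (cvgP l); rewrite /=.
by under eq_fun do rewrite [_ *: 1]mulr1.
Qed.

(** * The deterministic flow *)

Section Phi.
Context {R : realType} {N : nat}.
Variables (x : 'rV[R]_N) (phi : R -> 'rV[R]_N).
Hypothesis phiP : is_phi x phi.

Lemma phi_strict_chamber (s : R) : 0 <= s -> strict_chamber (phi s).
Proof. by move=> s0; apply: interior_weylD; case: (phiP.2 s s0). Qed.

Lemma phi_continuous i : {within `[0, +oo[, continuous (fun s => phi s 0 i)}.
Proof.
apply/subspace_continuousP => s; rewrite /= in_itv/= andbT => s0.
apply: (@cvg_punctured_within R `[0, +oo[ (fun s => phi s 0 i)).
have Q := (phiP.2 s s0).2 i.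
(* The limit is written as quotient limit times [s - s] plus the value, the form in which the
   difference quotient multiplied by [u - s] converges. *)
have -> : phi s 0 i = driftD (phi s) 0 i * (s - s) + phi s 0 i.
  by rewrite subrr mulr0 add0r.
have : (phi u 0 i - phi s 0 i) / (u - s) * (u - s) + phi s 0 i
    @[u --> within `[0, +oo[ (s^')] -->
    driftD (phi s) 0 i * (s - s) + phi s 0 i.
  apply: cvgD; last exact: cvg_cst.
  apply: cvgM => //; apply: cvgB; last exact: cvg_cst.
  by apply: cvg_within_filter; apply: cvg_within_filter; exact: cvg_id.
apply: cvg_trans; apply: near_eq_cvg; rewrite !near_withinE.
by apply: nearW => u us _; rewrite divfK ?subrK// subr_eq0.
Qed.

Lemma driftD_phi_continuous i :
  {within `[0, +oo[, continuous (fun s => driftD (phi s) 0 i)}.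
Proof.
apply/subspace_continuousP => s s0.
have ss : strict_chamber (phi s).
  by apply: phi_strict_chamber; move: s0; rewrite /= in_itv/= andbT.
have c j : phi u 0 j @[u --> within `[0, +oo[ (nbhs s)] --> phi s 0 j.
  exact: (iffLR (subspace_continuousP _ _) (phi_continuous (i := j)) s s0).
rewrite /from_subspace/= [driftD (phi s) 0 i]mxE.
under eq_cvg do rewrite /driftD mxE.
apply: cvg_big => [|j ji]; first exact: add_continuous.
apply: cvgD; apply: cvgV.
- move: ji; rewrite neq_ltn => /orP[] ij.
    by rewrite -opprB oppr_eq0 gt_eqF// (strict_chamber_sub ss ij).
  by rewrite gt_eqF// (strict_chamber_sub ss ij).
- by apply: cvgB; exact: c.
- by rewrite gt_eqF// strict_chamber_add.
- by apply: cvgD; exact: c.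
Qed.

Lemma sub_itv_cy (s : R) : `[0, s]%classic `<=` (`[0, +oo[%classic : set R).
Proof. by move=> u; rewrite /= !in_itv/= andbT => /andP[]. Qed.

Lemma driftD_phi_integrable i (s : R) :
  lebesgue_measure.-integrable `[0, s] (EFin \o (fun u => driftD (phi u) 0 i)).
Proof.
apply: (@continuous_compact_integrable R (fun u => driftD (phi u) 0 i)).
  exact: segment_compact.
exact: continuous_subspaceW (@sub_itv_cy s) (driftD_phi_continuous (i := i)).
Qed.

(** By the fundamental theorem of calculus: derivatives are taken only at interior times, where the
    quotient relative to the half-line is two-sided; at the endpoints continuity suffices. *)
Lemma phi_integral i (s : R) : 0 <= s ->
  phi s 0 i =
  phi 0 0 i + \int[lebesgue_measure]_(u in `[0, s]) driftD (phi u) 0 i.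
Proof.
rewrite le_eqVlt => /predU1P[<-|s0].
  by rewrite set_itv1 Rintegral_set1 addr0.
have cphi : {within `[0, s], continuous (fun u => phi u 0 i)}.
  exact: continuous_subspaceW (@sub_itv_cy s) (phi_continuous (i := i)).
have D u : u \in `]0, s[ -> derivable (fun u => phi u 0 i) u 1 /\
    derive1 (fun u => phi u 0 i) u = driftD (phi u) 0 i.
  rewrite in_itv/= => /andP[u0 us].
  apply: (@difference_quotient_derive1 R `[0, +oo[ (fun u => phi u 0 i)).
    apply: filterS (@lt_nbhsr R 0 u u0) => v v0.
    by rewrite /= in_itv/= andbT ltW.
  exact: (phiP.2 u (ltW u0)).2.
rewrite /Rintegral (@continuous_FTC2 R _ (fun u => phi u 0 i))//=.
- by rewrite addrCA subrr addr0.
- exact: continuous_subspaceW (@sub_itv_cy s) (driftD_phi_continuous (i := i)).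
- have [_ c0 cs] := iffLR (continuous_within_itvP _ s0) cphi.
  by split=> // u /D[].
- by move=> u /D[].
Qed.

(** The drift pulls the last coordinate towards 0: the two terms for [j] combine to
    [- 2 z_i^2 / (z_j^2 - z_i^2)], where [z_j > |z_i|]. *)
Lemma driftD_last_le0 (z : 'rV[R]_N) (i : 'I_N) :
  i.+1 = N -> strict_chamber z ->
  z 0 i * driftD z 0 i <= 0.
Proof.
move=> iN zs; rewrite /driftD mxE mulr_sumr; apply: sumr_le0 => j ji.
have ij : (j < i)%N.
  by rewrite ltn_neqAle ji -ltnS iN ltn_ord.
have a0 := strict_chamber_sub zs ij; have b0 := strict_chamber_add zs ji.
have -> : z 0 i * ((z 0 i - z 0 j)^-1 + (z 0 i + z 0 j)^-1) =
    - (2 * z 0 i ^+ 2 / ((z 0 j - z 0 i) * (z 0 i + z 0 j))).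
  by field; rewrite -(opprB (z 0 j)) oppr_eq0 !gt_eqF.
rewrite oppr_le0; apply: divr_ge0; last by rewrite ltW// mulr_gt0.
by rewrite mulr_ge0// sqr_ge0.
Qed.

(** The energy estimate for this single coordinate with constant 0: its square starts at 0 and
    cannot grow. *)
Lemma phi_last (i : 'I_N) (s : R) :
  i.+1 = N -> phi 0 0 i = 0 -> 0 <= s -> phi s 0 i = 0.
Proof.
move=> iN phi0 s0.
have := @energy_le R 1 s (fun _ u => phi u 0 i) (fun _ u => driftD (phi u) 0 i)
  (fun _ => driftD_phi_integrable i s) (fun _ u u0 _ => phi_integral i u0) 0 s0.
rewrite !big_ord1 phi0 expr0n/= add0r mulr0 mul0r => le0.
apply/eqP; rewrite -sqrf_eq0 eq_le sqr_ge0 andbT; apply: le0.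
apply: aeW => u /andP[u0 _]; rewrite big_ord1.
by apply: driftD_last_le0 => //; exact: phi_strict_chamber.
Qed.

(** By compactness, the finitely many positive roots stay uniformly away from 0 along [phi]. *)
Lemma phi_gap (t : R) : 0 <= t -> exists2 d : R, 0 < d &
  forall s : R, 0 <= s -> s <= t ->
    (forall i j : 'I_N, (i < j)%N -> d <= phi s 0 i - phi s 0 j) /\
    (forall i j : 'I_N, j != i -> d <= phi s 0 i + phi s 0 j).
Proof.
move=> t0.
have c i (s : R) : `[0, t]%classic s ->
    phi u 0 i @[u --> within `[0, t] (nbhs s)] --> phi s 0 i.
  move: s; apply/subspace_continuousP.
  exact: continuous_subspaceW (@sub_itv_cy t) (phi_continuous (i := i)).
have [d1 d10 d1P] := @finite_family_lb R _ t
  (fun p : 'I_N * 'I_N => (p.1 < p.2)%N)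
  (fun p s => phi s 0 p.1 - phi s 0 p.2) t0
  (fun p _ => iffRL (subspace_continuousP _ _)
    (fun s st => cvgB (c p.1 s st) (c p.2 s st)))
  (fun p s pP s0 _ => strict_chamber_sub (phi_strict_chamber s0) pP).
have [d2 d20 d2P] := @finite_family_lb R _ t
  (fun p : 'I_N * 'I_N => (p.2 != p.1)%N)
  (fun p s => phi s 0 p.1 + phi s 0 p.2) t0
  (fun p _ => iffRL (subspace_continuousP _ _)
    (fun s st => cvgD (c p.1 s st) (c p.2 s st)))
  (fun p s pP s0 _ => strict_chamber_add (phi_strict_chamber s0) pP).
exists (Num.min d1 d2); first by rewrite lt_min d10.
move=> s s0 st; split=> i j ij; rewrite ge_min.
  by rewrite (d1P (i, j) s ij s0 st).
by rewrite (d2P (i, j) s ij s0 st) orbT.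
Qed.

End Phi.

Lemma sqrt_sum_sqr_le {R : realType} {N : nat} (c : R) (a : 'I_N -> R) :
  0 <= c -> (forall i, `|a i| <= c) -> Num.sqrt (\sum_i a i ^+ 2) <= N%:R * c.
Proof.
move=> c0 ac; have Nc0 : 0 <= N%:R * c by rewrite mulr_ge0.
rewrite -[leRHS]ger0_norm// -sqrtr_sqr ler_wsqrtr//.
apply: (@le_trans _ _ (\sum_(i < N) c ^+ 2)).
  apply: ler_sum => i _.
  by rewrite -(@real_normK _ (a i)) ?num_real// ler_pXn2r// nnegrE.
rewrite sumr_const card_ord -[leLHS]mulr_natl exprMn ler_wpM2r ?sqr_ge0//.
by rewrite -natrX ler_nat; case: (N) => // n; rewrite leq_pmulr.
Qed.

(** In the folded coordinate [f] vanishes, so the reverse triangle inequality applies; the other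
    coordinates are unchanged. *)
Lemma abs_last_sub_le {R : realType} {N : nat} (z f w : 'rV[R]_N) (i : 'I_N) :
  (i.+1 = N -> f 0 i = 0) ->
  `|(abs_last z - f - abs_last w) 0 i| <= `|z 0 i - f 0 i - w 0 i|.
Proof.
move=> f0; rewrite /abs_last !mxE; case: eqP => // /f0 ->.
by rewrite !subr0; exact: ler_dist_dist.
Qed.

(** * The pathwise bound, uniform in the multiplicity *)

Section Pathwise.
Context {R : realType} {N : nat}.
Notation mu := (@lebesgue_measure R).
Variables (x : 'rV[R]_N) (phi b W : R -> 'rV[R]_N) (t : R).
Hypothesis phiP : is_phi x phi.
Hypothesis x_last : forall i : 'I_N, i.+1 = N -> x 0 i = 0.
Hypotheses (W0 : W 0 = 0)
  (WP : solves_integrated b (fun s z => driftW (phi s) z) W).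
Hypothesis t0 : 0 <= t.

Lemma W_bounded : exists2 M : R, 0 < M &
  forall i (s : R), 0 <= s -> s <= t -> `|W s 0 i| <= M.
Proof.
have [i _|M M0 MP] :=
  @finite_family_ub R 'I_N t xpredT (fun i s => `|W s 0 i|) t0.
  apply/subspace_continuousP => s st; apply: cvg_norm.
  apply: (@cvg_comp _ _ _ W (fun z : 'rV[R]_N => z 0 i) _ (nbhs (W s)));
    last exact: coord_continuous.
  have cW := continuous_subspaceW (@sub_itv_cy R t) WP.1.
  exact: (iffLR (subspace_continuousP _ _) cW s st).
by exists M => // i s; exact: MP.
Qed.

Section Shift.
Variables (d M : R).
Hypotheses (d0 : 0 < d) (M0 : 0 < M).
Hypothesis phi_d : forall s : R, 0 <= s -> s <= t ->
    (forall i j : 'I_N, (i < j)%N -> d <= phi s 0 i - phi s 0 j) /\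
    (forall i j : 'I_N, j != i -> d <= phi s 0 i + phi s 0 j).
Hypothesis W_M : forall i (s : R), 0 <= s -> s <= t -> `|W s 0 i| <= M.

Let V := 2 * M.
Let Q := V ^+ 2 / d.
Let P := Q * (N + N)%:R.
(** [Q] is the AM-GM threshold of [absorb]. Ordinals start at 0, so [q] is [Q] times
    [(N, ..., 2, 1)]: its positive roots are positive integer multiples of [Q], at most
    [2 N Q = P]. *)
Let q : 'rV[R]_N := \row_i (Q * (N - i)%:R).

Let Q0 : 0 <= Q. Proof. by rewrite divr_ge0 ?sqr_ge0// ltW. Qed.

Let P0 : 0 <= P. Proof. by rewrite mulr_ge0. Qed.

Let V0 : 0 <= V. Proof. by rewrite mulr_ge0// ltW. Qed.

Let Qnat (n : nat) : (0 < n <= N + N)%N -> Q <= Q * n%:R <= P.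
Proof.
move=> /andP[n0 nN]; rewrite -{1}[Q]mulr1.
by rewrite !ler_wpM2l// ?ler_nat// -[1]/(1%:R) ler_nat.
Qed.

Let qsub (i j : 'I_N) : (i < j)%N -> Q <= q 0 i - q 0 j <= P.
Proof.
move=> ij; rewrite !mxE -mulrBr -natrB; last by rewrite leq_sub2l// ltnW.
apply: Qnat; have := ltn_ord j; lia.
Qed.

Let qadd (i j : 'I_N) : j != i -> Q <= q 0 i + q 0 j <= P.
Proof.
by move=> _; rewrite !mxE -mulrDr -natrD; apply: Qnat; have := ltn_ord j; lia.
Qed.

Let q_le i : 0 <= q 0 i <= P.
Proof.
rewrite mxE mulr_ge0//= ler_wpM2l// ler_nat; lia.
Qed.

(** [C1 / c] will bound each coordinate of the linearization error and [C2 / c] the norm of [y]: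
    [N P / c] at time 0, plus the growth from [energy_norm_le]. Neither involves the
    multiplicity. *)
Let C1 := N%:R * (2 * remainder_cst d V P).
Let C2 := N%:R * P + 2 * (N%:R * C1) * t.

Section Multiplicity.
Variables (k : R) (X : R -> 'rV[R]_N).
Hypothesis k_ge : 2^-1 <= k.
Hypothesis X0 : X 0 = Num.sqrt k *: x.
Hypothesis X_int : {ae mu, forall s : R, 0 <= s -> weylD° (X s)}.
Hypothesis XP : solves_integrated b (fun _ z => k *: driftD z) X.

Let c := Num.sqrt k.

Let k0 : 0 < k. Proof. by apply: lt_le_trans k_ge; rewrite invr_gt0. Qed.

Let c0 : 0 < c. Proof. by rewrite sqrtr_gt0. Qed.

Let cc : c ^+ 2 = k. Proof. by rewrite sqr_sqrtr// ltW. Qed.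

Let c1 : 1 <= 2 * c ^+ 2. Proof. by rewrite cc; move: k_ge; lra. Qed.

Let r s := c *: phi s + W s + c^-1 *: q.
Let y i s := X s 0 i - r s 0 i.
(** The integrand of [y]: the driving path cancels between [X] and [W], and the shift [q / c] is
    constant in time. *)
Let h i s := (k *: driftD (X s)) 0 i - c * driftD (phi s) 0 i
             - driftW (phi s) (W s) 0 i.

Let rE i s : r s 0 i = c * phi s 0 i + W s 0 i + q 0 i / c.
Proof. by rewrite !mxE [_ / c]mulrC. Qed.

Let intX i (s : R) : 0 <= s ->
  mu.-integrable `[0, s] (EFin \o (fun u => (k *: driftD (X u)) 0 i)).
Proof. by move=> s0; case: (XP.2 s s0 i). Qed.

Let intW i (s : R) : 0 <= s ->
  mu.-integrable `[0, s] (EFin \o (fun u => driftW (phi u) (W u) 0 i)).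
Proof. by move=> s0; case: (WP.2 s s0 i). Qed.

Let intphi i (s : R) :
  mu.-integrable `[0, s] (EFin \o (fun u => c * driftD (phi u) 0 i)).
Proof.
by apply: integrable_scale => //; exact: (driftD_phi_integrable phiP).
Qed.

Let intXphi i (s : R) : 0 <= s -> mu.-integrable `[0, s]
  (EFin \o (fun u => (k *: driftD (X u)) 0 i - c * driftD (phi u) 0 i)).
Proof. by move=> s0; apply: integrable_diff => //; exact: intX. Qed.

Let inth i (s : R) : 0 <= s -> mu.-integrable `[0, s] (EFin \o h i).
Proof.
by move=> s0; apply: integrable_diff => //; [exact: intXphi|exact: intW].
Qed.

Let yE i (s : R) : 0 <= s -> y i s = y i 0 + \int[mu]_(u in `[0, s]) h i u.
Proof.
move=> s0; rewrite /h RintegralB//; [|exact: intXphi|exact: intW].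
rewrite RintegralB//; [|exact: intX].
rewrite RintegralZl//; last exact: (driftD_phi_integrable phiP).
rewrite /y !rE.
rewrite (XP.2 s s0 i).2 (WP.2 s s0 i).2 (phi_integral phiP i s0).
by ring.
Qed.

Let y0 i : y i 0 = - (q 0 i / c).
Proof.
rewrite /y rE X0 W0 phiP.1 [(_ *: x) 0 i]mxE [(0 : 'rV_N) 0 i]mxE -/c.
by ring.
Qed.

Let yh_le s : 0 <= s -> s <= t -> strict_chamber (X s) ->
  \sum_i y i s * h i s <= N%:R * (C1 / c) * Num.sqrt (\sum_i y i s ^+ 2).
Proof.
move=> s0 st Xs; have [fsub fadd] := phi_d s0 st.
have wV i : `|W s 0 i| <= V / 2 by rewrite /V mulrC mulKf//; exact: W_M.
have rs : strict_chamber (r s).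
  exact: (shifted_strict_chamber c0 c1 d0 wV fsub fadd qsub qadd).
have rest i : `|k * driftD (r s) 0 i - c * driftD (phi s) 0 i -
    driftW (phi s) (W s) 0 i| <= C1 / c.
  have := driftD_linearization c0 c1 d0 P0 wV fsub fadd qsub qadd i.
  by rewrite cc /C1 !mulrA.
set m := Num.sqrt _.
have ym i : `|y i s| <= m.
  rewrite -sqrtr_sqr ler_wsqrtr// (bigD1 i)//= lerDl.
  by apply: sumr_ge0 => j _; exact: sqr_ge0.
(* Inserting the drift at [r] splits the sum into a monotonicity term, which is nonpositive, and the
   linearization error. *)
have -> : \sum_i y i s * h i s =
    k * (\sum_i y i s * (driftD (X s) 0 i - driftD (r s) 0 i)) +
    \sum_i y i s * (k * driftD (r s) 0 i - c * driftD (phi s) 0 i -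
      driftW (phi s) (W s) 0 i).
  rewrite mulr_sumr -big_split/=; apply: eq_bigr => i _.
  by rewrite /h [(k *: driftD _) 0 i]mxE; ring.
rewrite -[leRHS]add0r; apply: lerD.
  by rewrite pmulr_rle0//; exact: driftD_antimonotone.
apply: (@le_trans _ _ (\sum_(i < N) (C1 / c) * m)); last first.
  by rewrite sumr_const card_ord -[leLHS]mulr_natl mulrA.
apply: ler_sum => i _; apply: (le_trans (ler_norm _)).
by rewrite normrM mulrC ler_pM.
Qed.

Let qc_le i : `|q 0 i / c| <= P / c.
Proof.
have /andP[qi0 qiP] := q_le i.
have qc0 : 0 <= q 0 i / c by apply: divr_ge0 => //; exact: ltW.
by rewrite ger0_norm// ler_pM2r// invr_gt0.
Qed.

Let C10 : 0 <= C1.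
Proof. by do 2![apply: mulr_ge0 => //]; exact: remainder_cst_ge0. Qed.

Let y_norm_le (s : R) : 0 <= s -> s <= t ->
  Num.sqrt (\sum_i y i s ^+ 2) <= C2 / c.
Proof.
move=> s0 st.
have K0 : 0 <= N%:R * (C1 / c) by rewrite mulr_ge0// divr_ge0// ltW.
have := @energy_norm_le R N s (N%:R * (C1 / c)) y h (fun i => inth i s0)
  (fun i u u0 _ => yE i u0) s0 K0.
move=> /(_ _)/le_trans; apply.
  apply: ae_imply X_int => u Xu /andP[u0 us].
  apply: yh_le => //; first exact: le_trans us st.
  by apply: interior_weylD; exact: Xu.
have -> : C2 / c = N%:R * (P / c) + 2 * (N%:R * (C1 / c)) * t.
  by rewrite /C2; ring.
apply: lerD.
  apply: sqrt_sum_sqr_le; first by apply: divr_ge0 => //; exact: ltW.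
  by move=> i; rewrite y0 normrN.
by rewrite ler_wpM2l// mulr_ge0.
Qed.

Lemma folded_error_le (s : R) : 0 <= s -> s <= t ->
  c * enorm (abs_last (X s) - c *: phi s - abs_last (W s)) <= N%:R * (C2 + P).
Proof.
move=> s0 st.
have C20 : 0 <= C2 by apply: addr_ge0; do 3?[apply: mulr_ge0 => //].
rewrite -ler_pdivlMl// mulrCA [c^-1 * _]mulrC; apply: sqrt_sum_sqr_le.
  by apply: divr_ge0; [exact: addr_ge0|exact: ltW].
move=> i; apply: (le_trans (abs_last_sub_le _ _ _)).
  move=> iN; rewrite mxE (phi_last phiP iN)// ?mulr0//.
  by rewrite phiP.1; exact: x_last.
(* The unshifted error is [y] plus the shift, both of order [1 / c]. *)
have -> : X s 0 i - (c *: phi s) 0 i - W s 0 i = y i s + q 0 i / c.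
  by rewrite /y rE [(c *: phi s) 0 i]mxE; ring.
apply: (le_trans (ler_normD _ _)); rewrite mulrDl; apply: lerD.
  apply: le_trans (y_norm_le s0 st).
  rewrite -sqrtr_sqr ler_wsqrtr// (bigD1 i)//= lerDl.
  by apply: sumr_ge0 => j _; exact: sqr_ge0.
exact: qc_le.
Qed.

End Multiplicity.
End Shift.

(** The gap [d] and the bound [M] come from [phi], [W] and [t] alone, so [C] is fixed before [k] and
    [X]. *)
Lemma pathwise_bound : exists C : R, forall (k : R) (X : R -> 'rV[R]_N),
  2^-1 <= k -> X 0 = Num.sqrt k *: x ->
  {ae mu, forall s : R, 0 <= s -> weylD° (X s)} ->
  solves_integrated b (fun _ z => k *: driftD z) X ->
  forall s : R, 0 <= s -> s <= t ->
  Num.sqrt k * enorm (abs_last (X s) - Num.sqrt k *: phi s - abs_last (W s))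
    <= C.
Proof.
have [d d0 phi_d] := phi_gap phiP t0.
have [M M0 W_M] := W_bounded.
(* The witness is read off from [folded_error_le]: [N (C2 + P)]. *)
eexists => k X k2 X0 X_int XP s s0 st.
exact: (folded_error_le d0 M0 phi_d W_M k2 X0 X_int XP s0 st).
Qed.

End Pathwise.

Theorem theorem5p3 (d : measure_display) (Omega : measurableType d)
    (R : realType) (P : probability Omega R) (N : nat) (hN : (2 <= N)%N)
    (x : 'rV[R]_N)
    (hx : forall i j : 'I_N, (i < j)%N -> x 0 j < x 0 i)
    (hxN : forall i : 'I_N, i.+1 = N -> x 0 i = 0)
    (B : R -> Omega -> 'rV[R]_N) (hB : brownian_motion P B)
    (X : R -> R -> Omega -> 'rV[R]_N) (hX : besselD_family P B x X)
    (phi : R -> 'rV[R]_N) (hphi : is_phi x phi)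
    (W : R -> Omega -> 'rV[R]_N) (hW : is_W P B phi W)
    (t : R) (ht : 0 < t) :
  {ae P, forall w,
    (ereal_sup [set y : \bar R | exists s k : R,
      [/\ (0 <= s)%R, (s <= t)%R, (2^-1 <= k)%R &
          y = (Num.sqrt k * enorm (besselB X k s w - Num.sqrt k *: phi s
                                   - abs_last (W s w)))%R%:E]]
     < +oo)%E}.
Proof.
have [_ aeX] := hX; have [_ aeW] := hW.
(* The exceptional set for [X] is common to all [k], so a single null set serves the whole
   supremum. *)
apply: filterS2 aeX aeW => w Xw [W0 WP].
have [C CP] := pathwise_bound hphi hxN W0 WP (ltW ht).
apply: (@le_lt_trans _ _ C%:E); last exact: ltry.
apply: ge_ereal_sup => _ [s [k [s0 st k2 ->]]].
have [X0 _ X_int XP] := Xw k k2.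
by rewrite lee_fin; exact: (CP k (fun s => X k s w)).
Qed.
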